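(* Define integers $C_{1^{4}2^{2}4^{-2}}(n)$ and $C_{1^{4}2^{4}4^{-3}}(n)$ by \[ \frac{(q;q)_\infty^{4}\,(q^2;q^2)_\infty^{2}}{(q^4;q^4)_\infty^{2}}=\sum_{n\geq 0} C_{1^{4}2^{2}4^{-2}}(n)\,q^n,\qquad \frac{(q;q)_\infty^{4}\,(q^2;q^2)_\infty^{4}}{(q^4;q^4)_\infty^{3}}=\sum_{n\geq 0} C_{1^{4}2^{4}4^{-3}}(n)\,q^n . \] Then: (1) The sequence $\{\operatorname{sgn}(C_{1^{4}2^{2}4^{-2}}(n))\}_{n\ge1}$ has period $8$; in particular, for every $n\ge1$, \[ \operatorname{sgn}\left(C_{1^{4}2^{2}4^{-2}}(n)\right)=\begin{cases}1&\text{if } n\equiv 0,3,7\pmod 8,\\ -1&\text{if } n\equiv 1,4,5\pmod 8,\\ 0&\text{if } n\equiv 2\pmod 4.\end{cases} \] (2) The sequence $\{\operatorname{sgn}(C_{1^{4}2^{4}4^{-3}}(n))\}_{n\ge1}$ has period $8$; in particular, for every $n\ge1$, \[ \operatorname{sgn}\left(C_{1^{4}2^{4}4^{-3}}(n)\right)=\begin{cases}1&\text{if } n\equiv 0,3,6,7\pmod 8,\\ -1&\text{if } n\equiv 1,2,4,5\pmod 8.\end{cases} \]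
   Context: $(a;q)_\infty:=\prod_{j\geq 0}(1-aq^j)$ denotes the $q$-Pochhammer symbol; the identities are identities of formal power series in $q$. *)

(* Defs.v *)
From mathcomp Require Import all_boot all_order all_algebra.
Set Implicit Arguments. Unset Strict Implicit. Unset Printing Implicit Defensive.
Import Order.TTheory GRing.Theory Num.Theory.
Local Open Scope ring_scope.

Definition series := nat -> int.

Definition sone : series := fun n => (n == 0)%:R.

Definition smul (f g : series) : series :=
  fun n => \sum_(i < n.+1) f i * g (n - i)%N.

Definition spow (f : series) (k : nat) : series := iter k (smul f) sone.

(* (q^k;q^k)_oo = prod_{j>=1} (1 - q^(k j)) as a formal power series:
   its n-th coefficient is that of the finite product over j <= n
   (the remaining factors are 1 + O(q^(n+1)) when k >= 1). *)
Definition qpoch_inf (k : nat) : series :=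
  fun n => (\prod_(1 <= j < n.+1) (1 - 'X^(k * j) : {poly int}))`_n.

(* Main.v *)
(* By the Gauss identity [(q;q)^2 = (q^2;q^2) A] with [A = sum_j (-1)^j q^(j^2)],
   the two quotients are [A(q)^2 A(q^2)^2] and [A(q)^2 A(q^2)^3].  Write
   [phi(q) = A(-q)] and [psi(q)] for the theta series of the triangular numbers.
   The classical 2-dissections of [phi] and [phi^2], together with
   [phi(q) A(q) = A(q^2)^2], express every subsequence of coefficients in a fixed
   residue class modulo 4 as, up to sign and up to [q -> -q], one of
     [phi^4], [phi^2 psi^2], [psi(q)^2 psi(q^2)^2],
     [phi^4 phi(q^2)], [phi^4 psi(q^4)], [phi^3 psi(q^2)^2].
   All of these have positive coefficients: for [phi^4] this is the four-square
   theorem of Lagrange, and the odd part of [phi^4] is a multiple of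
   [phi^2 psi(q^2)^2], whose even and odd parts are in turn [phi^2 psi^2] and
   a multiple of [psi(q)^2 psi(q^2)^2]. *)
From HB Require Import structures.
Require Import Defs.
From mathcomp Require Import all_boot all_order all_algebra.
From mathcomp Require Import boolp zify ring.
Import Order.TTheory GRing.Theory Num.Theory.
Local Open Scope ring_scope.
Set Implicit Arguments. Unset Strict Implicit. Unset Printing Implicit Defensive.

(** * Lagrange's four-square theorem *)

Definition sum4sq (n : int) :=
  exists a b c d : int, n = a ^+ 2 + b ^+ 2 + c ^+ 2 + d ^+ 2.

(** Euler's four-square identity: the witnesses are the coordinates of the quaternion (x, y, z, t)
    times the conjugate of (a, b, c, d). *)
Lemma sum4sqM (m n : int) : sum4sq m -> sum4sq n -> sum4sq (m * n).
Proof.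
move=> [a [b [c [d ->]]]] [x [y [z [t ->]]]].
exists (a * x + b * y + c * z + d * t), (a * y - b * x + c * t - d * z),
  (a * z - c * x + d * y - b * t), (a * t - d * x + b * z - c * y); ring.
Qed.

Lemma centered_residue (m x : int) : 0 < m ->
  exists y k : int, x = y + m * k /\ - m <= 2 * y <= m.
Proof.
move=> m0; pose r := (x %% m)%Z; pose k := (x %/ m)%Z.
have xE : x = k * m + r by exact: divz_eq.
have r0 : 0 <= r by apply: modz_ge0; lia.
have rm : r < m by apply: ltz_pmod.
case: (lerP (2 * r) m) => h.
  by exists r, k; split; [rewrite xE; ring | lia].
by exists (r - m), (k + 1); split; [rewrite xE; ring | lia].
Qed.

Lemma centered_sqr_le (m u : int) : - m <= 2 * u -> 2 * u <= m -> 4 * u ^+ 2 <= m ^+ 2.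
Proof.
move=> h1 h2; rewrite -subr_ge0.
rewrite (_ : _ - _ = (m - 2 * u) * (m + 2 * u)); last by ring.
by rewrite mulr_ge0 //; lia.
Qed.

Lemma centered_sqr_eq (m u : int) : 4 * u ^+ 2 = m ^+ 2 -> 2 * u = m \/ 2 * u = - m.
Proof.
move=> e; have /eqP : (2 * u) ^+ 2 = m ^+ 2 by rewrite -e; ring.
by rewrite eqf_sqr => /orP[] /eqP; [left | right].
Qed.

Lemma sum4_sqr_eq0 (x y z t : int) :
  x ^+ 2 + y ^+ 2 + z ^+ 2 + t ^+ 2 = 0 -> [/\ x = 0, y = 0, z = 0 & t = 0].
Proof.
have := sqr_ge0 x; have := sqr_ge0 y; have := sqr_ge0 z; have := sqr_ge0 t.
move=> h1 h2 h3 h4 E.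
by split; apply/eqP; rewrite -sqrf_eq0; apply/eqP; lia.
Qed.

(* The Fermat-Euler descent: dividing the product of [m p] with the sum of the
   squares of the centered residues modulo [m] by [m ^ 2]. *)
Lemma sum4sq_descent (p m : int) : 1 < m -> m < p ->
  (forall k : int, p = m * k -> False) -> sum4sq (m * p) ->
  exists r, [/\ 0 < r, r < m & sum4sq (r * p)].
Proof.
move=> m1 mp ndvd [a [b [c [d E]]]].
have m0 : 0 < m by lia.
have [x [k1 [aE /andP[x1 x2]]]] := centered_residue a m0.
have [y [k2 [bE /andP[y1 y2]]]] := centered_residue b m0.
have [z [k3 [cE /andP[z1 z2]]]] := centered_residue c m0.
have [t [k4 [dE /andP[t1 t2]]]] := centered_residue d m0.
have sq_le u := @centered_sqr_le m u.
pose K := k1 ^+ 2 + k2 ^+ 2 + k3 ^+ 2 + k4 ^+ 2.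
pose L := x * k1 + y * k2 + z * k3 + t * k4.
(* Inserting a = x + m k1 and its analogues in m p = a^2 + b^2 + c^2 + d^2 gives x^2 + y^2 + z^2 +
   t^2 = m (p - 2 L - m K). *)
pose r := p - 2 * L - m * K.
have mK : m * r = x ^+ 2 + y ^+ 2 + z ^+ 2 + t ^+ 2.
  rewrite /r /L /K !mulrBr E aE bE cE dE; ring.
have mI (u v : int) : m * u = m * v -> u = v by move=> e; apply: (mulfI _ e); lia.
have r_le : r <= m.
  have := sq_le x x1 x2; have := sq_le y y1 y2; have := sq_le z z1 z2.
  have := sq_le t t1 t2 => h1 h2 h3 h4.
  rewrite -(ler_pM2l m0) mK -expr2; move: h1 h2 h3 h4; clear; lia.
have r_ge : 0 <= r by rewrite -(ler_pM2l m0) mK mulr0 !addr_ge0 ?sqr_ge0.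
exists r; split.
- rewrite lt_neqAle r_ge andbT; apply/eqP => r0.
  have S0 : x ^+ 2 + y ^+ 2 + z ^+ 2 + t ^+ 2 = 0 by rewrite -mK -r0 mulr0.
  have [X Y Z T] := sum4_sqr_eq0 S0.
  apply: (ndvd K); apply: mI.
  rewrite E aE bE cE dE X Y Z T /K; ring.
(* If r = m, the four bounds 4 u^2 <= m^2 are equalities, so each residue is m/2 or -m/2. Then m
   divides 2 L, hence also p = m + 2 L + m K. *)
- rewrite lt_neqAle r_le andbT; apply/eqP => rm.
  have S0 : x ^+ 2 + y ^+ 2 + z ^+ 2 + t ^+ 2 = m ^+ 2 by rewrite -mK rm expr2.
  have hx := sq_le x x1 x2; have hy := sq_le y y1 y2; have hz := sq_le z z1 z2.
  have ht := sq_le t t1 t2.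
  have hX := @centered_sqr_eq m x ltac:(move: S0 hx hy hz ht; clear; lia).
  have hY := @centered_sqr_eq m y ltac:(move: S0 hx hy hz ht; clear; lia).
  have hZ := @centered_sqr_eq m z ltac:(move: S0 hx hy hz ht; clear; lia).
  have hT := @centered_sqr_eq m t ltac:(move: S0 hx hy hz ht; clear; lia).
  have [w mw] : exists w : int, m = 2 * w.
    by case: hX => h; [exists x | exists (- x)]; move: h; clear; lia.
  have xk u k : 2 * u = m \/ 2 * u = - m -> exists v, 2 * u * k = m * v.
    by case=> ->; [exists k | exists (- k)]; ring.
  have [v1 V1] := xk x k1 hX; have [v2 V2] := xk y k2 hY.
  have [v3 V3] := xk z k3 hZ; have [v4 V4] := xk t k4 hT.
  apply: (ndvd (1 + K + (v1 + v2 + v3 + v4))).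
  have pE : p = m + 2 * L + m * K by rewrite -[X in X + _ + _]rm /r; ring.
  rewrite pE; have -> : 2 * L = 2 * x * k1 + 2 * y * k2 + 2 * z * k3 + 2 * t * k4.
    by rewrite /L; ring.
  by rewrite V1 V2 V3 V4; ring.
(* Euler's identity writes (m r)(m p) as four squares whose roots are all multiples of m; the
   witnesses are these roots divided by m. *)
- pose A := x * k1 + y * k2 + z * k3 + t * k4 + r.
  exists A, (x * k2 - y * k1 + z * k4 - t * k3),
    (x * k3 - z * k1 + t * k2 - y * k4), (x * k4 - t * k1 + y * k3 - z * k2).
  apply: (mI); apply: mI.
  have -> : m * (m * (r * p)) = (m * r) * (m * p) by ring.
  have -> : m * (m * (A ^+ 2 + (x * k2 - y * k1 + z * k4 - t * k3) ^+ 2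
     + (x * k3 - z * k1 + t * k2 - y * k4) ^+ 2
     + (x * k4 - t * k1 + y * k3 - z * k2) ^+ 2))
    = (m * r + m * L) ^+ 2 + (m * (x * k2 - y * k1 + z * k4 - t * k3)) ^+ 2
     + (m * (x * k3 - z * k1 + t * k2 - y * k4)) ^+ 2
     + (m * (x * k4 - t * k1 + y * k3 - z * k2)) ^+ 2.
    by rewrite /A -/L; ring.
  rewrite mK E aE bE cE dE /L; ring.
Qed.

(** Pigeonhole in the field of p = 2h + 1 elements: for 0 <= i, j <= h the h + 1 values i^2 and the
    h + 1 values -j^2 - 1 must meet. So p divides i^2 + j^2 + 1, which is below p^2. *)
Lemma sum4sq_prime_multiple (p : nat) : prime p -> (2 < p)%N ->
  exists m : int, [/\ 0 < m, m < p%:Z & sum4sq (m * p%:Z)].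
Proof.
move=> pp p2.
have [h ph] : exists h, p = h.*2.+1.
  exists p./2; have := odd_double_half p.
  by have [E|->] := even_prime pp; [lia | rewrite add1n].
pose f (i : 'I_h.+1) : 'F_p := (i : nat)%:R ^+ 2.
pose g (i : 'I_h.+1) : 'F_p := - (i : nat)%:R ^+ 2 - 1.
have sq_inj (i j : 'I_h.+1) : ((i : nat)%:R : 'F_p) ^+ 2 = (j : nat)%:R ^+ 2 -> i = j.
  have li := ltn_ord i; have lj := ltn_ord j.
  wlog ij : i j li lj / (i <= j)%N.
    by move=> W e; case: (leqP i j) => c; [exact: W | apply/esym/W => //; lia].
  move/eqP; rewrite eq_sym -subr_eq0 subr_sqr mulf_eq0 -natrB // -natrD.
  rewrite -!(dvdn_pcharf (pchar_Fp pp)) => /orP[] /dvdnP[q qE]; apply: val_inj => /=.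
    by case: q qE => [|q] qE; nia.
  by case: q qE => [|q] qE; nia.
have finj : injective f by move=> i j; apply: sq_inj.
have ginj : injective g by move=> i j /addIr /oppr_inj; apply: sq_inj.
have [] : exists i j : 'I_h.+1, f i = g j.
  have : ~~ [disjoint [set f i | i in 'I_h.+1] & [set g i | i in 'I_h.+1]].
    apply/negP; rewrite -setI_eq0 => /eqP E.
    have := cardsUI [set f i | i in 'I_h.+1] [set g i | i in 'I_h.+1].
    rewrite E cards0 addn0 !card_imset // !card_ord => C.
    have := max_card (mem ([set f i | i in 'I_h.+1] :|: [set g i | i in 'I_h.+1])).
    rewrite C card_Fp //; lia.
  rewrite -setI_eq0 => /set0Pn[z]; rewrite inE => /andP[/imsetP[i _ ->] /imsetP[j _ E]].
  by exists i, j.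
move=> i [j /eqP]; rewrite /f /g -subr_eq0 => /eqP E.
have : (p %| i ^ 2 + j ^ 2 + 1)%N.
  rewrite (dvdn_pcharf (pchar_Fp pp)) !natrD !natrX -E; apply/eqP; ring.
case/dvdnP => m mE; exists m%:Z.
have li := ltn_ord i; have lj := ltn_ord j.
split; first by case: m mE => //; lia.
- have h1 : (i ^ 2 <= h ^ 2)%N by rewrite leq_exp2r.
  have h2 : (j ^ 2 <= h ^ 2)%N by rewrite leq_exp2r.
  rewrite ltz_nat; nia.
- exists i%:Z, j%:Z, 1, 0; rewrite -PoszM -mE; lia.
Qed.

(** The descent lowers the multiplier m until it reaches 1; primality of p excludes a divisor m with
    1 < m < p. *)
Lemma sum4sq_prime (p : nat) : prime p -> sum4sq p%:Z.
Proof.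
move=> pp; have p1 := prime_gt1 pp.
have [p2|p2] := leqP p 2.
  have -> : p = 2%N by lia.
  by exists 1, 1, 0, 0.
have [m [m0 mp S]] := sum4sq_prime_multiple pp p2.
have [s] := ubnP `|m|%N; elim: s m m0 mp S => // s IH m m0 mp S lts.
have [m1|m1] := lerP m 1; first by move: S; rewrite (_ : m = 1) ?mul1r //; lia.
have [k E|r [r0 rm Sr]] := sum4sq_descent m1 mp _ S; last by apply: (IH r) => //; lia.
have : (`|m| %| p)%N by apply/dvdnP; exists `|k|%N; nia.
by have /primeP[_ /[apply]] := pp; lia.
Qed.

Theorem lagrange_four_squares (n : nat) : sum4sq n%:Z.
Proof.
have [->|n0] := posnP n; first by exists 0, 0, 0, 0.
have [s] := ubnP n; elim: s n n0 => // s IH n n0 lts.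
have [n1|n1] := leqP n 1; first by exists 1, 0, 0, 0; lia.
have pp := pdiv_prime n1; have := divnK (pdiv_dvd n) => E.
rewrite -E PoszM; apply: sum4sqM; last exact: sum4sq_prime.
have := prime_gt1 pp => p1.
apply: IH; first by rewrite divn_gt0 ?pdiv_leq ?pdiv_gt0.
by apply: leq_trans (ltn_Pdiv p1 n0) _; lia.
Qed.

(** * The q-binomial theorem and Gauss's finite identity *)

(** The Gaussian binomial, defined by the q-Pascal rule so that no division occurs in R. *)
Fixpoint qbin (R : comNzRingType) (Q : R) (m k : nat) : R :=
  match m, k with
  | _, 0 => 1
  | 0, _.+1 => 0
  | m'.+1, k'.+1 => qbin Q m' k' + Q ^+ k * qbin Q m' k
  end.

(** The finite Pochhammer symbol (Q;Q)_n, without the usual division by (1 - Q)^n. *)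
Definition qfact (R : comNzRingType) (Q : R) (n : nat) : R :=
  \prod_(1 <= j < n.+1) (1 - Q ^+ j).

Section QBinomial.
Variables (R : comNzRingType) (Q : R).

Lemma qbin0 m : qbin Q m 0 = 1. Proof. by case: m. Qed.
Lemma qbinS m k :
  qbin Q m.+1 k.+1 = qbin Q m k + Q ^+ k.+1 * qbin Q m k.+1.
Proof. by []. Qed.

Lemma qbin_small m k : (m < k)%N -> qbin Q m k = 0.
Proof.
elim: m k => [|m IH] [|k] // ltmk; rewrite qbinS !IH ?mulr0 ?addr0 //; lia.
Qed.

Lemma qfact0 : qfact Q 0 = 1. Proof. by rewrite /qfact big_geq. Qed.
Lemma qfactS n : qfact Q n.+1 = qfact Q n * (1 - Q ^+ n.+1).
Proof. by rewrite /qfact big_nat_recr. Qed.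

Lemma qbin_fact a b :
  qbin Q (a + b) a * qfact Q a * qfact Q b = qfact Q (a + b).
Proof.
have [s] := ubnP (a + b); elim: s a b => // s IH [|a] b lts.
  by rewrite qbin0 qfact0 !mul1r.
case: b lts => [|b] lts.
  have := IH a 0%N ltac:(lia); rewrite !addn0 qbinS qfact0 !mulr1 => IHa.
  by rewrite (@qbin_small a a.+1) // mulr0 addr0 qfactS mulrA IHa.
have IH1 := IH a b.+1 ltac:(lia); have IH2 := IH a.+1 b ltac:(lia).
rewrite addSn qbinS [in RHS]qfactS -[in RHS]IH1.
have -> : Q ^+ (a + b.+1).+1 = Q ^+ a.+1 * Q ^+ b.+1 by rewrite -exprD.
rewrite addSnnS (qfactS a) in IH2; rewrite (qfactS b) in IH1 *.
rewrite (qfactS a).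
(* Both induction hypotheses have the same right side. The two sides of the goal differ by Q^(a+1)
   (1 - Q^(b+1)) times the difference of their left sides. *)
have := congr1 (fun z => z * Q ^+ a.+1 * (1 - Q ^+ b.+1)) (etrans IH2 (esym IH1)).
move=> /= E.
set y := qbin Q _ a.+1 in E *; set x := qbin Q _ a in E *.
set A := qfact Q a in E *; set B := qfact Q b in E *.
set u := Q ^+ _ in E *; set v := Q ^+ _ in E *.
apply/eqP; rewrite -subr_eq0; apply/eqP.
transitivity (y * (A * (1 - u)) * B * u * (1 - v) - x * A * (B * (1 - v)) * u * (1 - v)); first ring.
by rewrite E subrr.
Qed.

(** Stated homogeneously in x and y, so that a positive power of q can be put for y where the triple
    product would need negative exponents. The induction splits off the factor i = 0 and replaces x
    by x Q. *)
Lemma qbinomial_theorem (x y : R) m :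
  \prod_(i < m) (y + x * Q ^+ i) =
  \sum_(k < m.+1) Q ^+ 'C(k, 2) * qbin Q m k * x ^+ k * y ^+ (m - k).
Proof.
elim: m x => [|m IH] x.
  by rewrite big_ord0 big_ord1 !expr0 !mulr1.
rewrite big_ord_recl /= expr0 mulr1.
under eq_bigr => i _ do rewrite /bump /= add1n exprS mulrA.
rewrite IH mulrDl [in RHS]big_ord_recl /= ?qbin0 expr0 !mulr1 subn0 mul1r.
rewrite !mulr_sumr big_ord_recl /= ?qbin0 !expr0 !mulr1 subn0 mul1r -exprS -addrA.
congr (_ + _).
rewrite [X in _ + X]big_ord_recr /=.
have -> : \sum_(i < m.+1) Q ^+ 'C(bump 0 i, 2) * (qbin Q m i + Q ^+ i.+1 * qbin Q m i.+1)
             * x ^+ bump 0 i * y ^+ (m.+1 - bump 0 i) =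
  \sum_(i < m.+1) (Q ^+ 'C(i.+1, 2) * qbin Q m i * x ^+ i.+1 * y ^+ (m - i)
   + Q ^+ 'C(i.+1, 2) * (Q ^+ i.+1 * qbin Q m i.+1) * x ^+ i.+1 * y ^+ (m - i)).
  by apply: eq_bigr => i _; rewrite /bump /= add1n subSS mulrDr !mulrDl.
rewrite big_split /= addrC; congr (_ + _).
  rewrite [RHS]big_ord_recr; congr (_ + _) => [|/=]; first apply: eq_bigr => i _ /=.
    rewrite binS bin1 exprD exprMn (exprS x); ring.
  rewrite binS bin1 exprD exprMn (exprS x); ring.
rewrite [RHS]big_ord_recr /= qbin_small // !(mulr0, mul0r) addr0.
apply: eq_bigr => i _; rewrite /bump /= add1n.
rewrite (_ : m - i = (m - i.+1).+1)%N; last by have := ltn_ord i; lia.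
rewrite exprMn (exprS y); ring.
Qed.

Lemma double_bin2 k : (2 * 'C(k, 2) = k * k.-1)%N.
Proof. by elim: k => // k IH; rewrite binS bin1 mulnDr IH; case: k {IH} => // k; nia. Qed.

Lemma sum_double_ord n : (\sum_(i < n) 2 * i = n * n.-1)%N.
Proof. by elim: n => [|n IH]; rewrite ?big_ord0 // big_ord_recr /= IH; case: n {IH} => // n; nia. Qed.

End QBinomial.

(** Completes the square in the exponent of the k-th term: up to a constant depending on n, it is (k
    - n)^2. *)
Lemma gauss_exponent n k : (k <= 2 * n)%N ->
  ((2 * n).-1 * (2 * n - k) + k * k.-1 = 3 * n * n - 2 * n + `|k - n| ^ 2)%N.
Proof.
move=> lekn.
have h1 : (k * k.-1 + k = k * k)%N by case: k {lekn} => // k; lia.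
have h2 t : (t <= 2 * n -> (2 * n).-1 * t + t = 2 * n * t)%N by case: n {lekn} => [|n]; lia.
have h3 : (2 * n <= 3 * n * n)%N by case: n {lekn h2} => // n; lia.
have {h2} := h2 (2 * n - k)%N ltac:(lia).
move: h1 h3; set u := (k * k.-1)%N; set w := (_.-1 * _)%N; clearbody u w.
have [c|c] := leqP k n.
  rewrite distnEr //; have [e ->] : exists e, n = (k + e)%N by exists (n - k)%N; lia.
  rewrite addKn (_ : 2 * (k + e) - k = k + 2 * e)%N; last by lia.
  lia.
rewrite distnEl; last by lia.
have [e [t [-> ->]]] : exists e t, n = (t + e)%N /\ k = (t + 2 * e)%N.
  by exists (k - n)%N, (2 * n - k)%N; lia.
rewrite (_ : t + 2 * e - (t + e) = e)%N; last by lia.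
rewrite (_ : 2 * (t + e) - (t + 2 * e) = t)%N; last by lia.
lia.
Qed.

Section GaussFinite.
Variables (R : comNzRingType) (q : R).

Definition qodd n : R := \prod_(i < n) (1 - q ^+ (2 * i).+1).

(** Each factor with 2i < 2n - 1 is -q^(2i) (1 - q^(2(n-i)-1)); reversing the index yields [qodd].
    In [qodd_high] the other power of q is factored out. *)
Lemma qodd_low n :
  \prod_(i < n) (q ^+ (2 * n).-1 - q ^+ (2 * i)) =
  (-1) ^+ n * q ^+ (n * n.-1) * qodd n.
Proof.
rewrite -sum_double_ord expr_sum.
rewrite /qodd [X in _ * X](reindex_inj rev_ord_inj) -mulrA -big_split /=.
have -> : (-1) ^+ n = \prod_(i < n) (-1) :> R by rewrite prodr_const card_ord.
rewrite -big_split; apply: eq_bigr => i _ /=.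
have -> : ((2 * n).-1 = 2 * i + (2 * (n - i.+1)).+1)%N by have := ltn_ord i; lia.
rewrite exprD; ring.
Qed.

Lemma qodd_high n :
  \prod_(i < n) (q ^+ (2 * n).-1 - q ^+ (2 * (n + i))) =
  q ^+ (n * (2 * n).-1) * qodd n.
Proof.
rewrite (mulnC n) exprM.
have -> : q ^+ (2 * n).-1 ^+ n = \prod_(i < n) q ^+ (2 * n).-1.
  by rewrite prodr_const card_ord.
rewrite -big_split; apply: eq_bigr => i _ /=.
have -> : (2 * (n + i) = (2 * n).-1 + (2 * i).+1)%N by have := ltn_ord i; lia.
rewrite exprD; ring.
Qed.

(* The case [x = -1], [y = q ^ (2 n - 1)], base [q ^ 2] of the q-binomial
   theorem; the common power of [q] is what clears the negative exponents of
   the finite Jacobi triple product. *)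
Lemma gauss_finite_shifted n :
  q ^+ (3 * n * n - 2 * n) * qodd n ^+ 2 =
  q ^+ (3 * n * n - 2 * n) *
  \sum_(k < (2 * n).+1) (-1) ^+ (n + k) * q ^+ (`|k - n| ^ 2) * qbin (q ^+ 2) (2 * n) k.
Proof.
have := qbinomial_theorem (q ^+ 2) (-1) (q ^+ (2 * n).-1) (2 * n).
have -> : \prod_(i < 2 * n) (q ^+ (2 * n).-1 + -1 * q ^+ 2 ^+ i) =
   (-1) ^+ n * q ^+ (3 * n * n - 2 * n) * qodd n ^+ 2.
  rewrite (_ : 3 * n * n - 2 * n = n * n.-1 + n * (2 * n).-1)%N; last by nia.
  rewrite exprD (expr2 (qodd n)).
  transitivity ((-1) ^+ n * q ^+ (n * n.-1) * qodd n * (q ^+ (n * (2 * n).-1) * qodd n)).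
    have split2 m (F : nat -> R) : m = (n + n)%N ->
      \prod_(i < m) F i = (\prod_(i < n) F i) * (\prod_(i < n) F (n + i)%N).
      by move=> ->; rewrite big_split_ord.
    rewrite -qodd_low -qodd_high (split2 _ (fun i => q ^+ (2 * n).-1 + -1 * q ^+ 2 ^+ i)).
      by congr (_ * _); apply: eq_bigr => i _; rewrite -exprM mulN1r.
    by rewrite mul2n addnn.
  ring.
move=> /(congr1 (fun z => (-1) ^+ n * z)).
rewrite !mulrA -exprD addnn -mul2n exprM sqrrN expr1n expr1n mul1r => ->.
rewrite !mulr_sumr; apply: eq_bigr => k _; have ltk := ltn_ord k.
rewrite -!exprM double_bin2 exprD.
have E : q ^+ ((2 * n).-1 * (2 * n - k)) * q ^+ (k * k.-1) =
          q ^+ (3 * n * n - 2 * n) * q ^+ (`|k - n| ^ 2).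
  by rewrite -!exprD gauss_exponent //; lia.
transitivity (((-1) ^+ n * (-1) ^+ k * qbin (q ^+ 2) (2 * n) k) *
  (q ^+ ((2 * n).-1 * (2 * n - k)) * q ^+ (k * k.-1))); first ring.
by rewrite E; ring.
Qed.
End GaussFinite.

(** * The ring of formal power series *)

Lemma seriesP (f g : series) : f =1 g -> f = g.
Proof. by move=> fg; apply/funext. Qed.

Definition series_of_poly (p : {poly int}) : series := fun n => p`_n.

Definition poly_of_series (N : nat) (f : series) : {poly int} :=
  \poly_(i < N) f i.

(** Coefficient n of a product depends only on coefficients up to n, so the ring axioms can be
    transferred from polynomials by truncation. *)
Lemma smul_trunc (N n : nat) (f g : series) (p q : {poly int}) :
  (n < N)%N -> (forall i, (i < N)%N -> p`_i = f i) ->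
  (forall i, (i < N)%N -> q`_i = g i) -> smul f g n = (p * q)`_n.
Proof.
move=> ltnN pf qg; rewrite /smul coefM; apply: eq_bigr => i _.
by rewrite pf ?qg //; have := ltn_ord i; lia.
Qed.

Lemma coef_poly_of_series (N : nat) (f : series) i :
  (i < N)%N -> (poly_of_series N f)`_i = f i.
Proof. by move=> ltiN; rewrite coef_poly ltiN. Qed.

Definition szero : series := fun=> 0.
Definition sopp (f : series) : series := fun n => - f n.
Definition sadd (f g : series) : series := fun n => f n + g n.

Fact saddA : associative sadd.
Proof. by move=> f g h; apply: seriesP => n; rewrite /sadd addrA. Qed.
Fact saddC : commutative sadd.
Proof. by move=> f g; apply: seriesP => n; rewrite /sadd addrC. Qed.
Fact sadd0 : left_id szero sadd.
Proof. by move=> f; apply: seriesP => n; rewrite /sadd add0r. Qed.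
Fact saddN : left_inverse szero sopp sadd.
Proof. by move=> f; apply: seriesP => n; rewrite /sadd addNr. Qed.

Fact smulC : commutative smul.
Proof.
move=> f g; apply: seriesP => n; pose T := poly_of_series n.+1.
have cT := @coef_poly_of_series n.+1.
rewrite (@smul_trunc n.+1 n f g (T f) (T g)) //; try exact: cT.
by rewrite (@smul_trunc n.+1 n g f (T g) (T f)) 1?mulrC //; exact: cT.
Qed.

Fact smulA : associative smul.
Proof.
move=> f g h; apply: seriesP => n; pose T := poly_of_series n.+1.
have cT := @coef_poly_of_series n.+1.
have cTM a b i : (i < n.+1)%N -> (T a * T b)`_i = smul a b i.
  by move=> lti; rewrite (@smul_trunc n.+1 i a b (T a) (T b)) //; apply: cT.
rewrite (@smul_trunc n.+1 n f (smul g h) (T f) (T g * T h)) //;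
  try exact: cT; last by move=> i; exact: cTM.
by rewrite (@smul_trunc n.+1 n (smul f g) h (T f * T g) (T h)) 1?mulrA //; [exact: cTM | exact: cT].
Qed.

Fact smul1 : left_id sone smul.
Proof.
move=> f; apply: seriesP => n.
rewrite (@smul_trunc n.+1 n sone f 1 (poly_of_series n.+1 f)) //.
- by rewrite mul1r coef_poly_of_series.
- by move=> i _; rewrite coef1.
- exact: coef_poly_of_series.
Qed.

Fact smulDl : left_distributive smul sadd.
Proof.
move=> f g h; apply: seriesP => n.
by rewrite /smul /sadd -big_split; apply: eq_bigr => i _; rewrite mulrDl.
Qed.

Fact sone_neq0 : sone != szero :> (nat -> int).
Proof. by apply/eqP => /(congr1 (fun f : nat -> int => f 0%N)). Qed.

HB.instance Definition _ := Choice.copy series (nat -> int).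
HB.instance Definition _ :=
  GRing.isZmodule.Build series saddA saddC sadd0 saddN.
HB.instance Definition _ :=
  GRing.Zmodule_isComNzRing.Build series smulA smulC smul1 smulDl sone_neq0.

Lemma smulE (f g : series) : smul f g = f * g. Proof. by []. Qed.

Lemma spowE (f : series) k : spow f k = f ^+ k.
Proof. by elim: k => // k IH; rewrite exprS -IH. Qed.

Lemma coef_sD (f g : series) n : (f + g) n = f n + g n. Proof. by []. Qed.
Lemma coef_sN (f : series) n : (- f) n = - f n. Proof. by []. Qed.
Lemma coef_sM (f g : series) n : (f * g) n = \sum_(i < n.+1) f i * g (n - i)%N.
Proof. by []. Qed.
Lemma coef_s1 n : (1 : series) n = (n == 0)%:R. Proof. by []. Qed.

Lemma coef_sMn (f : series) m n : (f *+ m) n = f n *+ m.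
Proof. by elim: m => // m IH; rewrite !mulrS coef_sD IH. Qed.

Lemma coef_ssum (I : Type) (r : seq I) (F : I -> series) n :
  (\sum_(i <- r) F i) n = \sum_(i <- r) F i n.
Proof. by elim/big_rec2: _ => // i y1 y2 _ <-. Qed.

Fact series_of_poly_additive : zmod_morphism series_of_poly.
Proof. by move=> p q; apply: seriesP => n; rewrite /series_of_poly coefB. Qed.
Fact series_of_poly_multiplicative : monoid_morphism series_of_poly.
Proof.
split=> [|p q]; apply: seriesP => n; rewrite /series_of_poly.
  by rewrite coef1.
by rewrite coefM.
Qed.
HB.instance Definition _ := GRing.isZmodMorphism.Build _ _ _ series_of_poly_additive.
HB.instance Definition _ := GRing.isMonoidMorphism.Build _ _ _ series_of_poly_multiplicative.

(** * Gauss's theta identity *)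

Definition eqmod_deg (N : nat) (f g : series) := forall i, (i < N)%N -> f i = g i.

Lemma eqmod_degM N (f f' g g' : series) :
  eqmod_deg N f f' -> eqmod_deg N g g' -> eqmod_deg N (f * g) (f' * g').
Proof.
move=> ff gg i ltiN; rewrite !coef_sM; apply: eq_bigr => j _.
by have := ltn_ord j => ltj; rewrite ff ?gg //; lia.
Qed.

(** Coefficient i of u f is f i plus a combination of earlier coefficients of f, so f is recovered
    by strong induction. *)
Lemma eqmod_deg_cancel N (u f g : series) : u 0%N = 1 ->
  eqmod_deg N (u * f) (u * g) -> eqmod_deg N f g.
Proof.
move=> u0 ufg i; have [s] := ubnP i; elim: s i => // s IH i lts ltiN.
have := ufg i ltiN; rewrite !coef_sM !big_ord_recl /= u0 !mul1r subn0.
have -> : \sum_(j < i) u (bump 0 j) * f (i - bump 0 j)%N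
        = \sum_(j < i) u (bump 0 j) * g (i - bump 0 j)%N.
  apply: eq_bigr => j _; congr (_ * _); have := ltn_ord j => ltj.
  by apply: IH; rewrite /bump /=; lia.
exact: addIr.
Qed.

Lemma series_cancel (u f g : series) : u 0%N = 1 -> u * f = u * g -> f = g.
Proof.
move=> u0 ufg; apply: seriesP => n.
by apply: (@eqmod_deg_cancel n.+1 u) => // i _; rewrite ufg.
Qed.

Lemma coef0_sM (f g : series) : (f * g) 0%N = f 0%N * g 0%N.
Proof. by rewrite coef_sM big_ord1. Qed.

Lemma coef0_sX (f : series) k : f 0%N = 1 -> (f ^+ k) 0%N = 1.
Proof. by move=> f0; elim: k => // k IH; rewrite exprS coef0_sM f0 IH. Qed.

Lemma qpoch_inf0 k : qpoch_inf k 0 = 1.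
Proof. by rewrite /qpoch_inf big_geq // coef1. Qed.

(** The factor 1 - X^(k j) affects only degrees at least k j >= j, so factors with j > i leave
    coefficient i unchanged. *)
Lemma qfact_qpoch_inf k n i : (0 < k)%N -> (i <= n)%N ->
  (qfact ('X^k : {poly int}) n)`_i = qpoch_inf k i.
Proof.
move=> k0; elim: n => [|n IH] lein.
  by case: i lein => //; rewrite qfact0 coef1 qpoch_inf0.
move: lein; rewrite leq_eqVlt => /orP[/eqP ->|lein].
  by rewrite /qpoch_inf; under eq_bigr do rewrite exprM.
rewrite qfactS mulrBr mulr1 coefB -exprM coefMXn (_ : (_ < _)%N = true) ?subr0 ?IH //.
by nia.
Qed.

Lemma qfact_even_odd (R : comNzRingType) (q : R) n :
  qfact q (2 * n) = qodd q n * qfact (q ^+ 2) n.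
Proof.
elim: n => [|n IH]; first by rewrite !qfact0 /qodd big_ord0 mul1r.
rewrite (_ : 2 * n.+1 = (2 * n).+2)%N ?mulnS // !qfactS IH /qodd big_ord_recr /=.
rewrite -exprM (_ : 2 * n.+1 = (2 * n).+2)%N ?mulnS //; ring.
Qed.

Definition box (M : nat) : seq int := [seq j%:Z - M%:Z | j <- iota 0 (2 * M).+1].

Lemma mem_box M x : (x \in box M) = (`|x| <= M)%N.
Proof.
apply/mapP/idP => [[j]|le]; first by rewrite mem_iota => lej ->; lia.
by exists (absz (x + M%:Z)); [rewrite mem_iota | ]; lia.
Qed.

Lemma box_uniq M : uniq (box M).
Proof. by rewrite map_inj_uniq ?iota_uniq // => i j; lia. Qed.

Lemma big_box M (F : int -> int) :
  \sum_(x <- box M) F x = \sum_(j < (2 * M).+1) F (j%:Z - M%:Z).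
Proof. by rewrite big_map -val_enum_ord big_map big_enum. Qed.

(** Makes finite sums stand for sums over all integers or integer pairs: any two lists covering the
    same part of the support give the same value. *)
Lemma eq_sum_support (T : eqType) (r s : seq T) (F : T -> int) :
  uniq r -> uniq s -> (forall x, F x != 0 -> (x \in r) = (x \in s)) ->
  \sum_(x <- r) F x = \sum_(x <- s) F x.
Proof.
move=> ur us rs.
have supp t : \sum_(x <- t) F x = \sum_(x <- [seq x <- t | F x != 0]) F x.
  rewrite big_filter [LHS](bigID (fun x => F x != 0)) /= [X in _ + X]big1 ?addr0 //.
  by move=> x; rewrite negbK => /eqP.
rewrite supp [RHS]supp; apply: perm_big; apply: uniq_perm; rewrite ?filter_uniq //.
by move=> x; rewrite !mem_filter; case: eqP => //= /eqP /rs ->.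
Qed.

(** The theta series sum of q^(x^2) over all integers x; [box n] suffices since x^2 = n forces |x|
    <= n. *)
Definition phi : series := fun n => \sum_(x <- box n) (x ^+ 2 == n%:Z)%:R.

Lemma phi_box M n : (n <= M)%N -> phi n = \sum_(x <- box M) (x ^+ 2 == n%:Z)%:R.
Proof.
move=> leM; apply: eq_sum_support; rewrite ?box_uniq // => x.
case: eqP => // E _; rewrite !mem_box; nia.
Qed.

(** The alternating theta series sum of (-1)^j q^(k j^2); the sign is read off from j^2, which has
    the parity of j. *)
Definition theta (k : nat) : series :=
  fun n => if (k %| n)%N then (-1) ^+ (n %/ k) * phi (n %/ k)%N else 0.

(** Shifts the summation index by n, to match the sum in [gauss_finite_shifted] term by term. *)
Lemma theta_sum k n i : (0 < k)%N -> (i <= n)%N ->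
  theta k i = \sum_(j < (2 * n).+1) (-1) ^+ (n + j) * (i == k * `|j - n| ^ 2)%N%:R.
Proof.
move=> k0 lein; rewrite /theta; case: ifP => [/dvdnP[t E]|ndvd]; last first.
  rewrite big1 // => j _; case: eqP => [E|_]; last by rewrite mulr0.
  by rewrite E dvdn_mulr in ndvd.
subst i; rewrite mulnK // (@phi_box n) ?big_box ?mulr_sumr; last by nia.
apply: eq_bigr => j _.
rewrite (_ : (_ == _) = (t * k == k * `|j - n| ^ 2)%N); last first.
  rewrite (mulnC t) eqn_pmul2l // -eqz_nat.
  by apply/eqP/eqP => E; lia.
case: eqP => [E|_]; last by rewrite !mulr0.
congr (_ * _).
have {}E : t = (`|j - n| ^ 2)%N by apply/eqP; rewrite -(eqn_pmul2l k0) mulnC E.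
rewrite -[LHS]signr_odd -[RHS]signr_odd E oddX /=; congr (_ ^+ (nat_of_bool _)).
lia.
Qed.

Theorem gauss_square_theta k : (0 < k)%N ->
  qpoch_inf k ^+ 2 = qpoch_inf (2 * k) * theta k.
Proof.
move=> k0; apply: seriesP => i0.
(* With n = 2N, every j with |j - n| < N satisfies N <= j <= 2n - N, as [qbin1] requires. *)
pose N := i0.+1; pose n := (2 * N)%N.
pose q : {poly int} := 'X^k; pose E := qpoch_inf (2 * k).
suff : eqmod_deg N (qpoch_inf k ^+ 2) (E * theta k) by apply; rewrite /N.
have Sq m : (N <= m)%N -> eqmod_deg N (series_of_poly (qfact q m)) (qpoch_inf k).
  by move=> leNm i ltiN; apply: qfact_qpoch_inf => //; lia.
have Sq2 m : (N <= m)%N -> eqmod_deg N (series_of_poly (qfact (q ^+ 2) m)) E.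
  move=> leNm i ltiN; rewrite -exprM mulnC; apply: qfact_qpoch_inf => //; lia.
(* Modulo q^N all three factorials in [qbin_fact] are congruent to E, so E is congruent to qbin E^2,
   and one E cancels. *)
have qbin1 j : (N <= j)%N -> (j <= 2 * n - N)%N ->
    eqmod_deg N (series_of_poly (qbin (q ^+ 2) (2 * n) j) * E) 1.
  move=> leNj lej; apply: (@eqmod_deg_cancel _ E); first exact: qpoch_inf0.
  move=> i ltiN; rewrite mulr1 -(Sq2 (2 * n)%N) //; last by lia.
  have := qbin_fact (q ^+ 2) j (2 * n - j); rewrite subnKC; last by lia.
  move=> <-; rewrite !rmorphM /= mulrC.
  apply/esym; apply: eqmod_degM ltiN; last by apply: Sq2; lia.
  by apply: eqmod_degM => //; apply: Sq2; lia.
have finite : qodd q n ^+ 2 = \sum_(j < (2 * n).+1)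
    (-1) ^+ (n + j) * q ^+ (`|j - n| ^ 2) * qbin (q ^+ 2) (2 * n) j.
  have := gauss_finite_shifted q n; apply: mulfI.
  by rewrite -exprM expf_neq0 // polyX_eq0.
have oddE : eqmod_deg N (series_of_poly (qodd q n ^+ 2) * E) (theta k).
  move=> i ltiN; rewrite finite rmorph_sum /= mulr_suml coef_ssum.
  rewrite (@theta_sum k n) //; last by rewrite /n; lia.
  apply: eq_bigr => j _.
  have := ltn_ord j => ltj.
  rewrite rmorphM /= -mulrA.
  set c := series_of_poly _.
  have cE t : c t = (-1) ^+ (n + j) * (t == k * `|j - n| ^ 2)%N%:R.
    rewrite /c /series_of_poly -signr_odd mulr_sign -[in RHS]signr_odd mulr_sign.
    by case: (odd _); rewrite ?coefN -exprM coefXn.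
  (* A far term has degree k |j - n|^2 >= N and vanishes on both sides; for a near one the
     q-binomial cancels E. *)
  have [far|near] := leqP N `|j%:Z - n%:Z|%N.
    have c0 : eqmod_deg N c 0.
      move=> t ltt; rewrite cE (_ : (_ == _) = false) ?mulr0 //.
      by apply/eqP; nia.
    rewrite -cE (eqmod_degM c0 (fun _ _ => erefl) ltiN) mul0r.
    by rewrite c0.
  rewrite -cE -[in RHS](mulr1 c); apply: eqmod_degM ltiN => //.
  by apply: qbin1; rewrite /n in near *; lia.
move=> i ltiN.
transitivity ((series_of_poly (qfact q (2 * n)) ^+ 2) i).
  rewrite !expr2; apply/esym; apply: eqmod_degM ltiN; apply: Sq; rewrite /n; lia.
rewrite -rmorphXn qfact_even_odd exprMn rmorphM /=.
transitivity ((series_of_poly (qodd q n ^+ 2) * (E * E)) i).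
  apply: eqmod_degM ltiN => //; rewrite expr2 rmorphM.
  by apply: eqmod_degM; apply: Sq2; rewrite /n; lia.
by rewrite mulrA mulrC; apply: eqmod_degM ltiN.
Qed.

(** * Dissections *)

Definition qdilate (f : series) : series := fun n => if odd n then 0 else f n./2.
Definition qtwist (f : series) : series := fun n => (-1) ^+ n * f n.
Definition even_part (f : series) : series := fun n => f (2 * n)%N.
Definition odd_part (f : series) : series := fun n => f (2 * n).+1.
Definition qvar : series := series_of_poly 'X.

Lemma qdilate_even f n : qdilate f (2 * n)%N = f n.
Proof. by rewrite /qdilate mul2n odd_double doubleK. Qed.
Lemma qdilate_odd f n : qdilate f (2 * n).+1 = 0.
Proof. by rewrite /qdilate mul2n /= odd_double. Qed.

Lemma parity_cases n : (exists m, n = (2 * m)%N) \/ (exists m, n = (2 * m).+1).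
Proof.
by have := odd_double_half n; case: (odd n) => /= <-; [right | left]; exists n./2; lia.
Qed.

Lemma even_odd_ext (f g : series) :
  even_part f = even_part g -> odd_part f = odd_part g -> f = g.
Proof.
move=> E O; apply: seriesP => n; case: (parity_cases n) => [[m ->]|[m ->]].
  exact: (congr1 (fun h : series => h m) E).
exact: (congr1 (fun h : series => h m) O).
Qed.

Fact qdilate_additive : zmod_morphism qdilate.
Proof.
move=> f g; apply: seriesP => n; rewrite coef_sD coef_sN /qdilate.
by case: ifP; rewrite ?subrr.
Qed.

Fact qdilate_multiplicative : monoid_morphism qdilate.
Proof.
split=> [|f g]; apply: seriesP => n; case: (parity_cases n) => [[m ->]|[m ->]].
- by rewrite qdilate_even !coef_s1 muln_eq0.
- by rewrite qdilate_odd coef_s1.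
- rewrite qdilate_even !coef_sM.
  have evens (F : nat -> int) : (forall i, odd i -> F i = 0) ->
      \sum_(i < (2 * m).+1) F i = \sum_(i < m.+1) F (2 * i)%N.
    move=> F0; elim: m => [|m IH]; first by rewrite !big_ord1.
    rewrite (_ : 2 * m.+1 = (2 * m).+2)%N; last by lia.
    rewrite [LHS]big_ord_recr [X in X + _ = _]big_ord_recr [RHS]big_ord_recr /= -IH.
    by rewrite (F0 (2 * m).+1) /= ?mul2n ?odd_double // addr0 doubleS.
  rewrite (evens (fun i => qdilate f i * qdilate g (2 * m - i)%N)).
    by apply: eq_bigr => i _; rewrite -mulnBr !qdilate_even.
  by move=> i oi; rewrite /qdilate oi mul0r.
- rewrite qdilate_odd coef_sM big1 // => i _; rewrite /qdilate.
  case: ifP => oi; first by rewrite mul0r.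
  rewrite (_ : odd (_ - i) = true) ?mulr0 //.
  by have := ltn_ord i; move: oi; lia.
Qed.
HB.instance Definition _ := GRing.isZmodMorphism.Build _ _ _ qdilate_additive.
HB.instance Definition _ := GRing.isMonoidMorphism.Build _ _ _ qdilate_multiplicative.

Fact qtwist_additive : zmod_morphism qtwist.
Proof.
by move=> f g; apply: seriesP => n; rewrite /qtwist !coef_sD !coef_sN /qtwist mulrBr.
Qed.
Fact qtwist_multiplicative : monoid_morphism qtwist.
Proof.
split=> [|f g]; apply: seriesP => n.
  by rewrite /qtwist coef_s1; case: n => [|n]; rewrite ?mulr1 ?mulr0.
rewrite /qtwist !coef_sM mulr_sumr; apply: eq_bigr => i _.
rewrite mulrACA -exprD subnKC //; last by have := ltn_ord i; lia.
Qed.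
HB.instance Definition _ := GRing.isZmodMorphism.Build _ _ _ qtwist_additive.
HB.instance Definition _ := GRing.isMonoidMorphism.Build _ _ _ qtwist_multiplicative.

Lemma coef_qvarM f n : (qvar * f) n = if n is m.+1 then f m else 0.
Proof.
rewrite -smulE (@smul_trunc n.+1 n qvar f 'X (poly_of_series n.+1 f)) //.
  by rewrite coefXM; case: n => //= n; rewrite coef_poly_of_series.
exact: coef_poly_of_series.
Qed.

Lemma coef_qvar n : qvar n = (n == 1)%N%:R.
Proof. by rewrite /qvar /series_of_poly coefX. Qed.

Lemma even_part_dissection a b : even_part (qdilate a + qvar * qdilate b) = a.
Proof.
apply: seriesP => n; rewrite /even_part coef_sD qdilate_even coef_qvarM.
case: n => [|n]; first by rewrite addr0.
by rewrite mulnS /= qdilate_odd addr0.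
Qed.

Lemma odd_part_dissection a b : odd_part (qdilate a + qvar * qdilate b) = b.
Proof.
by apply: seriesP => n; rewrite /odd_part coef_sD qdilate_odd coef_qvarM qdilate_even add0r.
Qed.

Lemma dissection f : f = qdilate (even_part f) + qvar * qdilate (odd_part f).
Proof. by apply: even_odd_ext; rewrite ?even_part_dissection ?odd_part_dissection. Qed.

Lemma qdilate_qvar : qdilate qvar = qvar ^+ 2.
Proof.
apply: seriesP => n; rewrite expr2 coef_qvarM.
case: (parity_cases n) => [[m ->]|[m ->]].
  by rewrite qdilate_even; case: m => [|m]; rewrite ?mulnS /= !coef_qvar //; lia.
by rewrite qdilate_odd coef_qvar; lia.
Qed.

Lemma qtwist_qvar : qtwist qvar = - qvar.
Proof.
by apply: seriesP => -[|[|n]]; rewrite /qtwist coef_sN coef_qvar ?mulr0 ?mulr1 ?oppr0 ?expr1.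
Qed.

Lemma qtwist_qdilate f : qtwist (qdilate f) = qdilate f.
Proof.
apply: seriesP => n; rewrite /qtwist /qdilate -signr_odd.
by case: (odd n); rewrite ?mulr0 ?mul1r.
Qed.

(* This is [2 psi(q)]: [8 n + 1] is a square iff [n] is triangular, and a
   nonzero square has two roots. *)
Definition psi2 : series := fun n => phi (8 * n).+1.

(** * The 2-dissection of [phi] *)

Lemma phi_eq0 n : (forall x : int, x ^+ 2 != n%:Z) -> phi n = 0.
Proof. by move=> nsq; rewrite /phi big1 // => x _; rewrite (negbTE (nsq x)). Qed.

Lemma int_parity_cases (x : int) : (exists y, x = 2 * y) \/ (exists y, x = 2 * y + 1).
Proof.
have [y xE] : exists y, x = y * 2 + (x %% 2)%Z by exists (x %/ 2)%Z; exact: divz_eq.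
have r0 : 0 <= (x %% 2)%Z by apply: modz_ge0.
have r2 : (x %% 2)%Z < 2 by apply: ltz_pmod.
have [r|r] : (x %% 2)%Z = 0 \/ (x %% 2)%Z = 1 by lia.
  by left; exists y; lia.
by right; exists y; lia.
Qed.

Lemma phi_mul4 n : phi (4 * n) = phi n.
Proof.
rewrite {2}/phi.
transitivity (\sum_(x <- [seq 2 * y | y <- box n])
  ((x ^+ 2 == (4 * n)%N%:Z)%:R : int)).
  apply: eq_sum_support => [||x]; first exact: box_uniq.
    by rewrite map_inj_uniq ?box_uniq // => x y; lia.
  case: eqP => // E _; rewrite mem_box.
  have -> : (`|x| <= 4 * n)%N by nia.
  have [[y xE]|[y xE]] := int_parity_cases x; last by lia.
  by apply/esym/mapP; exists y; rewrite // mem_box; nia.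
rewrite big_map; apply: eq_bigr => y _; congr (nat_of_bool _)%:R.
by apply/eqP/eqP; lia.
Qed.

Lemma even_part_phi : even_part phi = qdilate phi.
Proof.
apply: seriesP => n; rewrite /even_part; case: (parity_cases n) => [[m ->]|[m ->]].
  by rewrite qdilate_even mulnA phi_mul4.
rewrite qdilate_odd phi_eq0 // => x; apply/eqP => E.
by have [[y xE]|[y xE]] := int_parity_cases x; move: E; rewrite xE; lia.
Qed.

(** Odd squares are 1 modulo 8, so only the exponents 8 k + 1 survive. *)
Lemma odd_part_phi : odd_part phi = qdilate (qdilate psi2).
Proof.
have phi_eq0_mod8 n t : n = (8 * t + 3)%N \/ n = (8 * t + 5)%N \/ n = (8 * t + 7)%N ->
    phi n = 0.
  move=> nE; rewrite phi_eq0 // => x; apply/eqP => E.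
  have [[y xE]|[y xE]] := int_parity_cases x; first by move: E; rewrite xE; lia.
  have [[z yE]|[z yE]] := int_parity_cases y; move: E; rewrite xE yE.
    by have [[u uE]|[u uE]] := int_parity_cases z; rewrite uE; lia.
  by have [[u uE]|[u uE]] := int_parity_cases z; rewrite uE; lia.
apply: seriesP => n; rewrite /odd_part; case: (parity_cases n) => [[m ->]|[m ->]].
  rewrite qdilate_even; case: (parity_cases m) => [[k ->]|[k ->]].
    by rewrite qdilate_even /psi2; congr (phi _); lia.
  by rewrite qdilate_odd (@phi_eq0_mod8 _ k) //; lia.
rewrite qdilate_odd; case: (parity_cases m) => [[k ->]|[k ->]].
  by rewrite (@phi_eq0_mod8 _ k) //; lia.
by rewrite (@phi_eq0_mod8 _ k) //; lia.
Qed.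

(** Classically, phi(q) = phi(q^4) + 2 q psi(q^8). *)
Lemma phi_dissection :
  phi = qdilate (qdilate phi) + qvar * qdilate (qdilate (qdilate psi2)).
Proof. by rewrite {1}(dissection phi) even_part_phi odd_part_phi. Qed.

(** * Sums of two squares and the 2-dissection of [phi ^+ 2] *)

Definition box2 M : seq (int * int) := [seq (x, y) | x <- box M, y <- box M].

Lemma mem_box2 M x y : ((x, y) \in box2 M) = (`|x| <= M)%N && (`|y| <= M)%N.
Proof.
rewrite -!mem_box; apply/allpairsP/andP => [[[u v] [/= ux vy [-> ->]]]|[xM yM]] //.
by exists (x, y).
Qed.

Lemma box2_uniq M : uniq (box2 M).
Proof. by apply: allpairs_uniq; rewrite ?box_uniq // => -[x y] [u v] _ _ /=. Qed.

Lemma phi_sqr_box2 n :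
  (phi ^+ 2) n = \sum_(p <- box2 n) (p.1 ^+ 2 + p.2 ^+ 2 == n%:Z)%:R.
Proof.
rewrite expr2 coef_sM big_allpairs /=.
transitivity (\sum_(i < n.+1) \sum_(x <- box n) \sum_(y <- box n)
    ((x ^+ 2 == i%:Z)%:R * (y ^+ 2 == (n - i)%N%:Z)%:R : int)).
  apply: eq_bigr => i _; rewrite (@phi_box n i) -1?ltnS ?ltn_ord // (@phi_box n) ?leq_subr //.
  by rewrite mulr_suml; apply: eq_bigr => x _; rewrite mulr_sumr.
rewrite exchange_big; apply: eq_bigr => x _; rewrite exchange_big; apply: eq_bigr => y _.
(* For fixed x and y only the index i = x^2 can contribute, and it is in range exactly when x^2 <=
   n. *)
have [le|lt] := leqP (`|x| ^ 2) n; last first.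
  rewrite big1 => [|i _]; first by case: eqP => //; nia.
  by have := ltn_ord i; case: eqP => [E|_]; rewrite ?mul0r //; nia.
rewrite (bigD1 (Ordinal (le : `|x| ^ 2 < n.+1)%N)) //= big1 ?addr0 => [|i /eqP ne].
  rewrite (_ : (x ^+ 2 == _) = true) ?mul1r; last by apply/eqP; lia.
  congr (nat_of_bool _)%:R; apply/eqP/eqP; lia.
case: eqP => [E|_]; rewrite ?mul0r //; case: ne; apply: val_inj => /=; lia.
Qed.

Lemma absz_le_sum_sqr (x y : int) n : x ^+ 2 + y ^+ 2 = n%:Z -> (`|x| <= n)%N.
Proof. by have := sqr_ge0 y; move: (y ^+ 2) => z; nia. Qed.

(* [(x, y) |-> (x + y, x - y)] maps the representations of [n] as a sum of two
   squares bijectively onto those of [2 n]. *)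
Lemma even_part_phi_sqr : even_part (phi ^+ 2) = phi ^+ 2.
Proof.
apply: seriesP => n; rewrite /even_part !phi_sqr_box2.
pose rot (p : int * int) : int * int := (p.1 + p.2, p.1 - p.2).
have rot_inj : injective rot by move=> [x y] [u v] [h1 h2]; congr (_, _); lia.
transitivity (\sum_(p <- [seq rot p | p <- box2 n])
    ((p.1 ^+ 2 + p.2 ^+ 2 == (2 * n)%N%:Z)%:R : int)).
  apply: eq_sum_support => [||[u v]]; first exact: box2_uniq.
    by rewrite map_inj_uniq ?box2_uniq.
  rewrite -[(u, v).1]/u -[(u, v).2]/v; case: (u ^+ 2 + v ^+ 2 =P _) => // E _; rewrite mem_box2.
  rewrite (absz_le_sum_sqr E). rewrite (@absz_le_sum_sqr v u (2 * n)) 1?addrC ?andbT //.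
  (* Since u^2 + v^2 is even, u and v have the same parity; (v + w, w) is then the preimage of (u,
     v). *)
  have [w uE] : exists w, u = v + 2 * w.
    have [[s E1]|[s E1]] := int_parity_cases u; have [[t E2]|[t E2]] := int_parity_cases v.
    - by exists (s - t); lia.
    - by move: E; rewrite E1 E2; lia.
    - by move: E; rewrite E1 E2; lia.
    - by exists (s - t); lia.
  apply: esym.
  have -> : (u, v) = rot (v + w, w) by rewrite /rot /= uE; congr (_, _); lia.
  rewrite (mem_map rot_inj) mem_box2.
  have {E} : (v + w) ^+ 2 + w ^+ 2 = n%:Z by move: E; rewrite uE; lia.
  by move=> E; rewrite (absz_le_sum_sqr E) (@absz_le_sum_sqr w (v + w) n) 1?addrC.
rewrite big_map; apply: eq_bigr => -[x y] _ /=; congr (nat_of_bool _)%:R.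
by apply/eqP/eqP; lia.
Qed.

(** Classically, phi(q)^2 = phi(q^2)^2 + 4 q psi(q^4)^2. Squaring [phi_dissection] and taking even
    parts gives the right side, while [phi ^+ 2] is its own even part. *)
Lemma phi_sqr_dissection :
  phi ^+ 2 = qdilate (phi ^+ 2) + qvar * qdilate (qdilate (psi2 ^+ 2)).
Proof.
rewrite -[LHS]even_part_phi_sqr.
rewrite -[RHS](@even_part_dissection _ (qdilate phi * qdilate (qdilate psi2) *+ 2)).
congr even_part; rewrite {1}phi_dissection !(rmorphD, rmorphM, rmorphXn, rmorphMn) /=.
rewrite !qdilate_qvar; ring.
Qed.

(** Both sides equal phi(q^4)^2 - 4 q^2 psi(q^8)^2: the left as a difference of squares, the right
    by [phi_sqr_dissection] at -q^2. *)
Lemma phi_mul_qtwist : phi * qtwist phi = qdilate (qtwist phi ^+ 2).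
Proof.
rewrite -rmorphXn phi_sqr_dissection !(rmorphD, rmorphM, rmorphXn) /= !qtwist_qdilate.
rewrite qtwist_qvar rmorphN /= qdilate_qvar.
rewrite {1 2}phi_dissection !(rmorphD, rmorphM) /= !qtwist_qdilate qtwist_qvar.
ring.
Qed.

Lemma qtwist_phi_sqr :
  qtwist phi ^+ 2 = qdilate (phi ^+ 2) - qvar * qdilate (qdilate (psi2 ^+ 2)).
Proof.
by rewrite -rmorphXn {1}phi_sqr_dissection rmorphD rmorphM /= !qtwist_qdilate qtwist_qvar mulNr.
Qed.

(** * Positivity of the theta products *)

Definition snonneg (f : series) := forall n, 0 <= f n.
Definition spositive (f : series) := forall n, 0 < f n.

Lemma snonnegM f g : snonneg f -> snonneg g -> snonneg (f * g).
Proof. by move=> f0 g0 n; rewrite coef_sM sumr_ge0 // => i _; rewrite mulr_ge0. Qed.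

Lemma coef_sM_gt0 f g a b : snonneg f -> snonneg g -> 0 < f a -> 0 < g b ->
  0 < (f * g) (a + b)%N.
Proof.
move=> f0 g0 fa gb; have lt : (a < (a + b).+1)%N by lia.
rewrite coef_sM (bigD1 (Ordinal lt)) //= addKn ltr_wpDr ?mulr_gt0 //.
by rewrite sumr_ge0 // => i _; rewrite mulr_ge0.
Qed.

Lemma spositiveM f g : spositive f -> snonneg g -> 0 < g 0%N -> spositive (f * g).
Proof.
move=> f0 g0 g00 n; rewrite -[n]addn0; apply: coef_sM_gt0 => //.
by move=> m; apply: ltW.
Qed.

Lemma phi_ge0 : snonneg phi.
Proof. by move=> n; rewrite sumr_ge0. Qed.

Lemma phi_sqr_gt0 (x : int) : 0 < phi (`|x| ^ 2)%N.
Proof.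
rewrite /phi (bigD1_seq x) ?box_uniq ?mem_box //=; last by nia.
rewrite (_ : (x ^+ 2 == _) = true) ?ltr_wpDr ?sumr_ge0 //; apply/eqP; lia.
Qed.

Lemma qdilate_ge0 f : snonneg f -> snonneg (qdilate f).
Proof. by move=> f0 n; rewrite /qdilate; case: ifP. Qed.

Lemma psi2_ge0 : snonneg psi2.
Proof. by move=> n; apply: phi_ge0. Qed.

Lemma phi4_gt0 : spositive (phi ^+ 4).
Proof.
have sq (u : int) : u ^+ 2 = (`|u| ^ 2)%N%:Z by lia.
move=> n; have [x [y [z [t nE]]]] := lagrange_four_squares n.
move: nE; rewrite !sq -!PoszD -!addnA => -[->].
have nn := snonnegM phi_ge0 phi_ge0; have nnn := snonnegM phi_ge0 nn.
rewrite !exprS expr0 mulr1.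
by do 3!(apply: coef_sM_gt0; rewrite ?phi_sqr_gt0 //; try exact: phi_ge0).
Qed.

Lemma phi2_dilate_psi2_gt0 : spositive (phi ^+ 2 * qdilate (psi2 ^+ 2)).
Proof.
have E : odd_part (phi ^+ 4) = (phi ^+ 2 * qdilate (psi2 ^+ 2)) *+ 2.
  (* The square of [phi_sqr_dissection] has this even part, and twice the cross term as odd part. *)
  rewrite -[RHS](odd_part_dissection (phi ^+ 4 + qvar * qdilate (psi2 ^+ 2) ^+ 2)).
  congr odd_part; rewrite (exprM phi 2 2) {1}phi_sqr_dissection.
  rewrite !(rmorphD, rmorphM, rmorphXn, rmorphMn) /= qdilate_qvar; ring.
move=> n; have := phi4_gt0 (2 * n).+1; rewrite -[X in 0 < X]/(odd_part (phi ^+ 4) n) E coef_sMn.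
by rewrite pmulrn_lgt0.
Qed.

Lemma phi2_dilate_psi2_dissection :
  phi ^+ 2 * qdilate (psi2 ^+ 2) =
  qdilate (phi ^+ 2 * psi2 ^+ 2) + qvar * qdilate (qdilate (psi2 ^+ 2) * psi2 ^+ 2).
Proof. by rewrite {1}phi_sqr_dissection !rmorphM /=; ring. Qed.

Lemma phi2_psi2_gt0 : spositive (phi ^+ 2 * psi2 ^+ 2).
Proof.
move=> n; have := phi2_dilate_psi2_gt0 (2 * n)%N; rewrite phi2_dilate_psi2_dissection.
by rewrite -[X in 0 < X]/(even_part _ n) even_part_dissection.
Qed.

Lemma dilate_psi2_psi2_gt0 : spositive (qdilate (psi2 ^+ 2) * psi2 ^+ 2).
Proof.
move=> n; have := phi2_dilate_psi2_gt0 (2 * n).+1; rewrite phi2_dilate_psi2_dissection.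
by rewrite -[X in 0 < X]/(odd_part _ n) odd_part_dissection.
Qed.

(** * Dissections and coefficient signs of the two theta quotients *)

Definition first_quotient : series := qtwist phi ^+ 2 * qdilate (qtwist phi ^+ 2).
Definition second_quotient : series := qtwist phi ^+ 2 * qdilate (qtwist phi ^+ 3).

Lemma phi2_qtwist_phi2 : phi ^+ 2 * qtwist phi ^+ 2 = qdilate (qtwist (phi ^+ 4)).
Proof. by rewrite -exprMn phi_mul_qtwist !rmorphXn /= -!exprM. Qed.

(** By [qtwist_phi_sqr] the even part is phi(q)^2 phi(-q)^2 = phi(-q^2)^4, a series in q^2, whence
    the zeros at 2 modulo 4. In the odd part the factor phi(-q)^2 is dissected once more. *)
Lemma first_quotient_dissection :
  first_quotient = qdilate (qdilate (qtwist (phi ^+ 4)))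
   + qvar * qdilate (- qdilate (phi ^+ 2 * psi2 ^+ 2)
                     + qvar * qdilate (qdilate (psi2 ^+ 2) * psi2 ^+ 2)).
Proof.
rewrite /first_quotient {1}qtwist_phi_sqr -phi2_qtwist_phi2.
have -> : - qdilate (phi ^+ 2 * psi2 ^+ 2) + qvar * qdilate (qdilate (psi2 ^+ 2) * psi2 ^+ 2)
   = - (qdilate (psi2 ^+ 2) * qtwist phi ^+ 2).
  by rewrite qtwist_phi_sqr !rmorphM /=; ring.
by rewrite rmorphN !rmorphM /=; ring.
Qed.

(** The even part phi(q)^2 phi(-q)^3 = phi(-q^2)^4 phi(-q) is split again by [phi_dissection] at -q.
    The odd part needs no further split: it is minus the twist of a positive series. *)
Lemma second_quotient_dissection :
  second_quotient =
    qdilate (qdilate (qtwist (phi ^+ 4 * qdilate phi))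
             + qvar * qdilate (- qtwist (phi ^+ 4 * qdilate (qdilate psi2))))
   + qvar * qdilate (- qtwist (phi ^+ 2 * qdilate (psi2 ^+ 2) * phi)).
Proof.
have -> : qdilate (qtwist (phi ^+ 4 * qdilate phi))
             + qvar * qdilate (- qtwist (phi ^+ 4 * qdilate (qdilate psi2)))
   = phi ^+ 2 * qtwist phi ^+ 3.
  rewrite (exprS (qtwist phi)) mulrCA phi2_qtwist_phi2.
  rewrite [X in _ = qtwist X * _]phi_dissection.
  rewrite !(rmorphD, rmorphN, rmorphM) /= !qtwist_qdilate qtwist_qvar; ring.
rewrite /second_quotient {1}qtwist_phi_sqr.
rewrite !(rmorphN, rmorphM, rmorphXn) /= !qtwist_qdilate; ring.
Qed.

Lemma first_quotient_sgz m :
  [/\ sgz (first_quotient (4 * m)%N) = (-1) ^+ m,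
      sgz (first_quotient (4 * m + 1)%N) = -1,
      sgz (first_quotient (4 * m + 2)%N) = 0 &
      sgz (first_quotient (4 * m + 3)%N) = 1].
Proof.
have E0 k : first_quotient (2 * k)%N = qdilate (qtwist (phi ^+ 4)) k.
  rewrite -[LHS]/(even_part _ k) first_quotient_dissection.
  by rewrite even_part_dissection.
have E1 k : first_quotient (2 * k).+1 = (- qdilate (phi ^+ 2 * psi2 ^+ 2)
                     + qvar * qdilate (qdilate (psi2 ^+ 2) * psi2 ^+ 2)) k.
  rewrite -[LHS]/(odd_part _ k) first_quotient_dissection.
  by rewrite odd_part_dissection.
split.
- rewrite (_ : 4 * m = 2 * (2 * m))%N ?E0 ?qdilate_even; last by lia.
  by rewrite /qtwist sgzM (gtr0_sgz (phi4_gt0 m)) mulr1 sgzX sgzN1.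
- rewrite (_ : 4 * m + 1 = (2 * (2 * m)).+1)%N; last by lia.
  rewrite E1 -rmorphN -[X in sgz X]/(even_part _ m) even_part_dissection.
  by rewrite coef_sN sgzN gtr0_sgz //; apply: phi2_psi2_gt0.
- rewrite (_ : 4 * m + 2 = 2 * (2 * m).+1)%N; last by lia.
  by rewrite E0 qdilate_odd.
- rewrite (_ : 4 * m + 3 = (2 * (2 * m).+1).+1)%N; last by lia.
  rewrite E1 -rmorphN -[X in sgz X]/(odd_part _ m) odd_part_dissection.
  by rewrite gtr0_sgz //; apply: dilate_psi2_psi2_gt0.
Qed.

Lemma second_quotient_sgz m :
  [/\ sgz (second_quotient (4 * m)%N) = (-1) ^+ m,
      sgz (second_quotient (4 * m + 2)%N) = - (-1) ^+ m &
      sgz (second_quotient (2 * m).+1) = - (-1) ^+ m].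
Proof.
have phi0 : 0 < phi 0 by exact: (phi_sqr_gt0 0).
have psi0 : 0 < psi2 0 by exact: (phi_sqr_gt0 1).
have sgz_qtwist f k : spositive f -> sgz (qtwist f k) = (-1) ^+ k.
  by move=> f0; rewrite /qtwist sgzM (gtr0_sgz (f0 k)) mulr1 sgzX sgzN1.
have E0 k : second_quotient (2 * k)%N = (qdilate (qtwist (phi ^+ 4 * qdilate phi))
             + qvar * qdilate (- qtwist (phi ^+ 4 * qdilate (qdilate psi2)))) k.
  rewrite -[LHS]/(even_part _ k) second_quotient_dissection.
  by rewrite even_part_dissection.
split.
- rewrite (_ : 4 * m = 2 * (2 * m))%N; last by lia.
  rewrite E0 -[X in sgz X]/(even_part _ m) even_part_dissection; apply: sgz_qtwist.
  by apply: spositiveM phi4_gt0 _ _ => //; apply: qdilate_ge0; apply: phi_ge0.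
- rewrite (_ : 4 * m + 2 = 2 * (2 * m).+1)%N; last by lia.
  rewrite E0 -[X in sgz X]/(odd_part _ m) odd_part_dissection coef_sN sgzN.
  congr (- _); apply: sgz_qtwist; apply: spositiveM phi4_gt0 _ _ => //.
  by do 2!apply: qdilate_ge0; apply: psi2_ge0.
- rewrite -[X in sgz X]/(odd_part _ m) second_quotient_dissection odd_part_dissection.
  rewrite coef_sN sgzN; congr (- _); apply: sgz_qtwist.
  by apply: spositiveM phi2_dilate_psi2_gt0 _ _ => //; apply: phi_ge0.
Qed.

(** * Identification of the eta quotients and the signs modulo 8 *)

Lemma theta1 : theta 1 = qtwist phi.
Proof. by apply: seriesP => n; rewrite /theta dvd1n divn1. Qed.

Lemma theta2 : theta 2 = qdilate (qtwist phi).
Proof.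
apply: seriesP => n; rewrite /theta /qdilate dvdn2 divn2.
by case: (odd n).
Qed.

Lemma mod8_cases n : exists k r, n = (8 * k + r)%N /\ (r < 8)%N.
Proof. by exists (n %/ 8)%N, (n %% 8)%N; lia. Qed.

Theorem theorem1p4 (C1 C2 : series) :
  (* C1 = coefficients of (q;q)^4 (q^2;q^2)^2 / (q^4;q^4)^2 *)
  smul C1 (spow (qpoch_inf 4) 2)
    = smul (spow (qpoch_inf 1) 4) (spow (qpoch_inf 2) 2) ->
  (* C2 = coefficients of (q;q)^4 (q^2;q^2)^4 / (q^4;q^4)^3 *)
  smul C2 (spow (qpoch_inf 4) 3)
    = smul (spow (qpoch_inf 1) 4) (spow (qpoch_inf 2) 4) ->
  ((forall n : nat, (1 <= n)%N -> sgz (C1 (n + 8)%N) = sgz (C1 n)) /\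
   (forall n : nat, (1 <= n)%N ->
      sgz (C1 n) = if (n %% 8 \in [:: 0; 3; 7])%N then 1
                   else if (n %% 8 \in [:: 1; 4; 5])%N then -1
                   else 0)) /\
  ((forall n : nat, (1 <= n)%N -> sgz (C2 (n + 8)%N) = sgz (C2 n)) /\
   (forall n : nat, (1 <= n)%N ->
      sgz (C2 n) = if (n %% 8 \in [:: 0; 3; 6; 7])%N then 1 else -1)).
Proof.
have G1 := @gauss_square_theta 1 isT; have G2 := @gauss_square_theta 2 isT.
rewrite theta1 in G1; rewrite theta2 in G2.
rewrite !spowE !smulE => H1 H2.
have E1 : C1 = first_quotient.
  apply: (@series_cancel (qpoch_inf 4 ^+ 2)); first exact/coef0_sX/qpoch_inf0.
  rewrite mulrC H1 (exprM _ 2 2) G1 /first_quotient rmorphXn.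
  (* [G1] turns the fourth power into two further factors [qpoch_inf 2]; [G2] then converts each
     square of [qpoch_inf 2]. *)
  transitivity ((qpoch_inf 2 ^+ 2) ^+ 2 * qtwist phi ^+ 2); first ring.
  by rewrite G2 /=; ring.
have E2 : C2 = second_quotient.
  apply: (@series_cancel (qpoch_inf 4 ^+ 3)); first exact/coef0_sX/qpoch_inf0.
  rewrite mulrC H2 (exprM (qpoch_inf 1) 2 2) G1 /second_quotient rmorphXn.
  transitivity ((qpoch_inf 2 ^+ 2) ^+ 3 * qtwist phi ^+ 2); first ring.
  by rewrite G2 /=; ring.
have sgn_even m : (-1) ^+ (2 * m) = 1 :> int by rewrite exprM sqrrN !expr1n.
have sgn_odd m : (-1) ^+ (2 * m).+1 = -1 :> int by rewrite exprS sgn_even.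
have S1 n : sgz (C1 n) = if (n %% 8 \in [:: 0; 3; 7])%N then 1
                   else if (n %% 8 \in [:: 1; 4; 5])%N then -1 else 0.
  rewrite E1; have [k [r [-> ltr]]] := mod8_cases n.
  (* Taking m = 2k covers the residues 0 to 3 modulo 8, and m = 2k + 1 the residues 4 to 7. *)
  have [a0 a1 a2 a3] := first_quotient_sgz (2 * k).
  have [b0 b1 b2 b3] := first_quotient_sgz (2 * k).+1.
  rewrite mulnC modnMDl modn_small // -(mulnC 8).
  rewrite ?sgn_even ?sgn_odd in a0 b0.
  have at_index i j v : i = j -> sgz (first_quotient j) = v -> sgz (first_quotient i) = v.
    by move=> ->.
  case: r ltr => [|[|[|[|[|[|[|[|//]]]]]]]] _;
    [apply: at_index a0 | apply: at_index a1 | apply: at_index a2 | apply: at_index a3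
    |apply: at_index b0 | apply: at_index b1 | apply: at_index b2 | apply: at_index b3];
    lia.
have S2 n : sgz (C2 n) = if (n %% 8 \in [:: 0; 3; 6; 7])%N then 1 else -1.
  rewrite E2; have [k [r [-> ltr]]] := mod8_cases n.
  have [a0 a2 _] := second_quotient_sgz (2 * k).
  have [b0 b2 _] := second_quotient_sgz (2 * k).+1.
  (* The odd indices 8k + 1, 8k + 3, 8k + 5, 8k + 7 are 2m + 1 for m = 4k, ..., 4k + 3. *)
  have [_ _ c1] := second_quotient_sgz (2 * (2 * k)).
  have [_ _ c3] := second_quotient_sgz (2 * (2 * k)).+1.
  have [_ _ c5] := second_quotient_sgz (2 * (2 * k).+1).
  have [_ _ c7] := second_quotient_sgz (2 * (2 * k).+1).+1.
  rewrite mulnC modnMDl modn_small // -(mulnC 8).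
  rewrite ?sgn_even ?sgn_odd ?opprK in a0 a2 b0 b2 c1 c3 c5 c7.
  have at_index i j v : i = j -> sgz (second_quotient j) = v -> sgz (second_quotient i) = v.
    by move=> ->.
  case: r ltr => [|[|[|[|[|[|[|[|//]]]]]]]] _;
    [apply: at_index a0 | apply: at_index c1 | apply: at_index a2 | apply: at_index c3
    |apply: at_index b0 | apply: at_index c5 | apply: at_index b2 | apply: at_index c7];
    lia.
split; split=> n _; rewrite ?S1 ?S2 //.
  by rewrite modnDr.
by rewrite modnDr.
Qed.
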